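(* Let $d$ be a nonnegative integer and let $H_2(x)=(x+1)^{d+1}-x^{d+1}\in\mathbb{R}[x]$. If $H_2$ is written in the form $$H_2(x)=\sum_{i=1}^l \beta_i (x+y_i)^{e_i}$$ with real constants $\beta_i,y_i$ and nonnegative integers $e_i \leq d$ for every $i$, then $l > (d-1)/2$. *)

(* Defs.v *)
From HB Require Import structures.
From mathcomp Require Import all_boot all_order all_algebra.
From mathcomp Require Import reals.

Set Implicit Arguments.
Unset Strict Implicit.
Unset Printing Implicit Defensive.

Import GRing.Theory.
Local Open Scope ring_scope.

Definition H2 (R : realType) (d : nat) : {poly R} :=
  ('X + 1) ^+ d.+1 - 'X ^+ d.+1.

(* Main.v *)
Require Import Defs.
From HB Require Import structures.
From mathcomp Require Import all_boot all_order all_algebra.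
From mathcomp Require Import polyorder polyrcf cauchyreals zify.
From mathcomp Require Import reals.

(** The apolar pairing turns the identity into: [P.[1] = P.[0]] for every [P] of
    degree at most [d + 1] such that [P^`(d + 1 - e i)] vanishes at [y i] for
    all [i].  Suppose [2 l <= d].  Cover the [l] conditions [(y i, d + 1 - e i)]
    by at most [l] disjoint pairs [(x, k), (x, k + 1)], and let [D] be minimal
    such that fewer than [D / 2] of these pairs start at a level [<= D]; then
    [D <= 2 l + 1 <= d + 1], and linear algebra gives a nonzero [P] of degree at
    most [D] with [P.[0] = 0] that satisfies both conditions of every pair.
    Hence [P.[1] = 0] too.  Each differentiation costs at most one real root by
    Rolle, while each pair starting at the new level adds two: a sign change of
    the derivative at [x] has odd multiplicity, so it cannot be absorbed by the
    double root.  At level [deg P] this contradicts the minimality of [D]. *)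

Set Implicit Arguments.
Unset Strict Implicit.
Unset Printing Implicit Defensive.

Import Order.TTheory GRing.Theory Num.Theory.
Local Open Scope ring_scope.

(** * Rolle's theorem with parities of multiplicities *)

(** A root [c] of even multiplicity lets the square of ['X - c] be split off, which changes neither
    signs nor parities; once no root is left, the sign is constant. *)
Lemma even_mu_sign_constant (R : rcfType) (p : {poly R}) (a b : R) :
    p != 0 -> {in `]a, b[, forall x, ~~ odd (\mu_x p)} ->
  {in `]a, b[, forall x, 0 <= p.[x]} \/ {in `]a, b[, forall x, p.[x] <= 0}.
Proof.
have [n] := ubnP (size p); elim: n p => // n IHn p lt_p_n p0 even_mu.
case Er: (roots p a b) => [|c s].
  have noroot := roots_nil p0 Er.
  have sgE := polyrN0_itv noroot.
  have [ab|ba] := ltP a b; last first.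
    by left=> x; rewrite in_itv /= => /andP[/lt_trans h/h]; rewrite ltNge ba.
  have mab : (a + b) / 2%:R \in `]a, b[ by rewrite mid_in_itv.
  have [mge0|mlt0] := lerP 0 p.[(a + b) / 2%:R].
    left=> x xab; rewrite -sgr_ge0 (sgE _ _ mab xab) sgr_ge0 //.
  by right=> x xab; rewrite -sgr_le0 (sgE _ _ mab xab) sgr_le0 ltW.
have : c \in roots p a b by rewrite Er mem_head.
rewrite in_roots => /and3P[rc cab _].
have mu2 : (2 <= \mu_c p)%N.
  by have := even_mu c cab; have := mu_gt0 c p0; rewrite rc; case: (\mu_c p) => [|[]].
have [q pE] : exists q, p = q * ('X - c%:P) ^+ 2.
  by apply/dvdpP; rewrite root_le_mu.
have q0 : q != 0 by apply: contraNneq p0 => q0; rewrite pE q0 mul0r.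
have sgE x : p.[x] = q.[x] * (x - c) ^+ 2.
  by rewrite pE hornerM horner_exp hornerXsubC.
have [|||qs|qs] := IHn q.
- by move: lt_p_n; rewrite pE size_Mmonic ?monic_exp ?monicXsubC // size_exp_XsubC; lia.
- by [].
- move=> x /even_mu; rewrite pE mu_mul -?pE // mu_exp.
  by rewrite oddD oddM andbF addbF.
- by left=> x xab; rewrite sgE mulr_ge0 ?sqr_ge0 ?qs.
- by right=> x xab; rewrite sgE mulr_le0_ge0 ?sqr_ge0 ?qs.
Qed.

(* Between consecutive roots the derivative changes sign. *)
Lemma rolle_odd_mu (R : rcfType) (p : {poly R}) (a b : R) :
    a < b -> root p a -> root p b -> {in `]a, b[, forall x, ~~ root p x} ->
  exists2 c, c \in `]a, b[ & odd (\mu_c p^`()).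
Proof.
move=> ab ra rb noroot.
have mab : (a + b) / 2%:R \in `]a, b[ by rewrite mid_in_itv.
have mab' : (a + b) / 2%:R \in `[a, b] by rewrite mid_in_itv //= ltW.
have aab : a \in `[a, b] by rewrite in_itv /= lexx ltW.
have bab : b \in `[a, b] by rewrite in_itv /= lexx ltW.
have [am mb] : a <= (a + b) / 2%:R /\ (a + b) / 2%:R <= b.
  by move: mab'; rewrite in_itv /= => /andP[].
have dp0 : p^`() != 0.
  apply: contra_not_neq (negP (noroot _ mab)) => dp0.
  have am' : a < (a + b) / 2%:R by move: mab; rewrite in_itv /= => /andP[].
  rewrite /root -(rootP ra); have [c _] := poly_mvt p am'.
  by rewrite dp0 horner0 mul0r => /eqP; rewrite subr_eq0.
case Eo: (has (fun c => odd (\mu_c p^`())) (roots p^`() a b)).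
  have /hasP[c] := Eo; rewrite in_roots => /and3P[_ cab _] odd_c.
  by exists c.
have even_mu : {in `]a, b[, forall x, ~~ odd (\mu_x p^`())}.
  move=> x xab; apply/negP => odd_x; move/hasPn: Eo => /(_ x).
  rewrite in_roots xab dp0 andbT -(mu_gt0 _ dp0) odd_x odd_gt0 //.
  by move=> /(_ isT).
(* A derivative of constant sign makes [p] monotone, so equal values at [a] and [b] force a root at
   the midpoint. *)
case: (negP (noroot _ mab)); rewrite /root; apply/eqP/le_anti.
case: (even_mu_sign_constant dp0 even_mu) => sg.
  have mon := ler_hornerW sg.
  by rewrite -{1}(rootP rb) -(rootP ra) !mon.
have sg' x : x \in `]a, b[ -> (- p)^`().[x] >= 0.
  by move=> xab; rewrite derivN hornerN oppr_ge0 sg.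
have mon := ler_hornerW sg'.
rewrite -[_.[_] <= 0]lerN2 -[0 <= _.[_]]lerN2 oppr0 -!hornerN.
have -> : 0 = (- p).[a] by rewrite hornerN (rootP ra) oppr0.
rewrite mon //=.
have -> : (- p).[a] = (- p).[b] by rewrite !hornerN (rootP ra) (rootP rb).
by rewrite mon.
Qed.

Lemma mem_rootsR (R : rcfType) (p : {poly R}) :
  p != 0 -> forall x, (x \in rootsR p) = root p x.
Proof. by move=> p0 x; rewrite (roots_onP (roots_on_rootsR p0)) ?in_itv. Qed.

Lemma count_roots_le_rolle (R : rcfType) (p : {poly R}) (Y : seq R) :
    p != 0 -> uniq Y -> (forall x, root p^`() x -> x \in Y) ->
  (count (root p) Y <= (count (fun x => ~~ root p x && odd (\mu_x p^`())) Y).+1)%N.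
Proof.
move=> p0 uY sY; pose C x := ~~ root p x && odd (\mu_x p^`()).
have rR := mem_rootsR p0.
(* Induction along the sorted roots; the guard [a < x] keeps the points found in different gaps
   distinct. *)
have consecutive (s : seq R) (a : R) : path <%R a s -> root p a -> {subset s <= root p} ->
    (forall x, root p x -> a < x -> x \in s) ->
    (size s <= count (fun x => (a < x)%R && C x) Y)%N.
  elim: s a => //= b s IHs a /andP[ab pbs] ra sr rs.
  have rb : root p b by apply: sr; rewrite mem_head.
  have bs : all (> b) s by apply: order_path_min pbs => ? ? ? /lt_trans; apply.
  have [|c cab oc] := rolle_odd_mu ab ra rb.
    move=> x /[!in_itv] /= /andP[ax xb]; apply/negP => /rs/(_ ax).
    rewrite inE (lt_eqF xb) /= => /(allP bs) /=.
    by rewrite ltNge (ltW xb).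
  have Cc : C c.
    rewrite /C oc andbT; apply/negP => /rs.
    move: cab; rewrite in_itv /= => /andP[-> cb] /(_ isT).
    rewrite inE (lt_eqF cb) /= => /(allP bs) /=.
    by rewrite ltNge (ltW cb).
  have /IHs : path <%R b s := pbs.
  move=> /(_ rb) IH.
  have {}IH : (size s <= count (fun x => (b < x)%R && C x) Y)%N.
    apply: IH => [x xs|x rx bx]; first by apply: sr; rewrite inE xs orbT.
    by have := rs x rx (lt_trans ab bx); rewrite inE (gt_eqF bx).
  apply: (@leq_trans (count (pred1 c) Y + count (fun x => (b < x)%R && C x) Y)%N).
    rewrite -add1n leq_add // count_uniq_mem // sY //.
    have dp0 : p^`() != 0 by apply: contraTneq oc => ->; rewrite mu0.
    by rewrite -mu_gt0 // odd_gt0.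
  rewrite -count_predUI [X in (_ + X)%N](_ : _ = 0%N) ?addn0.
    apply: sub_count => x /= /orP[/eqP->|/andP[bx ->]].
      by rewrite Cc andbT; move: cab; rewrite in_itv /= => /andP[].
    by rewrite (lt_trans ab bx).
  apply/eqP; rewrite -leqn0 leqNgt -has_count; apply/hasP => -[x _ /=].
  case/and3P=> /eqP-> bc _; move: cab; rewrite in_itv /= => /andP[_].
  by rewrite ltNge (ltW bc).
apply: (@leq_trans (size (rootsR p))).
  rewrite -size_filter; apply: uniq_leq_size; first exact: filter_uniq.
  by move=> x; rewrite mem_filter rR => /andP[].
case E: (rootsR p) => [|a s] //=; rewrite ltnS.
have := sorted_roots (- cauchy_bound p) (cauchy_bound p) p.
rewrite -[roots _ _ _]/(rootsR p) E /= => pas.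
have rE x : root p x = (x \in a :: s) by rewrite -E rR.
apply: leq_trans (sub_count _ Y) => [|x /andP[_ /=]]; last exact.
apply: (consecutive s a) => // [|x xs|x].
- by rewrite rE mem_head.
- by change (root p x); rewrite rE inE xs orbT.
- by rewrite rE inE => /orP[/eqP->|//]; rewrite ltxx.
Qed.

(** * Multiplicities of successive derivatives, and disjoint pairs of levels *)

Lemma mu_derivn_nroot (R : realDomainType) (p : {poly R}) (x : R) :
  p != 0 -> ~~ root p^`(\mu_x p) x.
Proof.
move Em : (\mu_x p) => m; elim: m p Em => [|m IHm] p Em p0.
  by rewrite derivn0 -mu_gt0 // Em.
have rx : root p x by rewrite -mu_gt0 // Em.
have dp0 : p^`() != 0.
  apply: contraTneq rx => dp0; suff /eqP/size_poly1P[c c0 ->] : size p = 1%N by rewrite rootC.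
  have := size_deriv p; rewrite dp0 size_poly0.
  by move: p0; rewrite -size_poly_gt0; case: (size p) => [|[]].
by rewrite derivSn IHm // mu_deriv // Em subn1.
Qed.

(** [k] stands for the pair of levels [k], [k + 1]; the condition makes these pairs disjoint. *)
Definition spaced (J : pred nat) := forall k, J k -> ~~ J k.+1.

Lemma count_spaced (J : pred nat) (a n : nat) : spaced J ->
    (forall j, (a <= j < a + n)%N -> J j -> (j.+1 < a + n)%N) ->
  (2 * count J (iota a n) <= n)%N.
Proof.
move=> spJ; have [k] := ubnP n; elim: k a n => // k IHk a [|n] //= lt_n inJ.
have [Ja|nJa] /= := boolP (J a); last first.
  rewrite add0n ltnW // ltnS IHk // => j lt_j Jj.
  by have := inJ j _ Jj; rewrite addSnnS; apply; lia.
have := inJ a; case: n => [|n] in lt_n inJ *; first by move=> /(_ _ Ja); lia.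
move=> _ /=; rewrite (negPf (spJ _ Ja)) add0n mulnDr muln1 ltnS ltnS.
apply: IHk => [|j lt_j Jj]; first lia.
by have := inJ j _ Jj; lia.
Qed.

Definition derivn_vanish (R : realDomainType) (p : {poly R}) (x : R) (J : pred nat) :=
  forall j, J j -> root p^`(j) x /\ root p^`(j.+1) x.

(* The roots of [p^`(m)] at [x] fill the levels [m, ..., m + mu - 1]; those
   belonging to a pair of [J] that starts above [m] are credited later. *)
Definition net_mu (R : realDomainType) (p : {poly R}) (x : R) (J : pred nat) (m : nat) :=
  (\mu_x p^`(m) - 2 * count J (iota m.+1 (\mu_x p^`(m)).-1))%N.

(** The derivative of order [m + mu] does not vanish at [x], so no pair straddles the upper end of
    the block of vanishing levels. *)
Lemma derivn_vanish_lt (R : realDomainType) (p : {poly R}) (x : R) (J : pred nat) m j :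
    p^`(m) != 0 -> derivn_vanish p x J -> J j ->
    (j < m + \mu_x p^`(m))%N -> (j.+1 < m + \mu_x p^`(m))%N.
Proof.
move=> pm0 van Jj lt_j; have [_ rj] := van j Jj.
rewrite ltn_neqAle lt_j andbT; apply: contraTneq rj => ->.
by rewrite addnC /derivn iterD mu_derivn_nroot.
Qed.

(** Disjoint pairs are packed into the [mu] levels from [m] on, then into the [mu - 1] levels above
    [m]. Hence the truncated subtraction in [net_mu] is exact. *)
Lemma count_net_mu (R : realDomainType) (p : {poly R}) (x : R) (J : pred nat) m :
    p^`(m) != 0 -> spaced J -> derivn_vanish p x J -> root p^`(m) x ->
  (2 * J m + 2 * count J (iota m.+1 (\mu_x p^`(m)).-1) <= \mu_x p^`(m)
   /\ 2 * count J (iota m.+1 (\mu_x p^`(m)).-1) < \mu_x p^`(m))%N.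
Proof.
move=> pm0 spJ van rm; have mu0 : (0 < \mu_x p^`(m))%N by rewrite mu_gt0.
have lt_van j := @derivn_vanish_lt R p x J m j pm0 van.
move: mu0 lt_van; case: (\mu_x p^`(m)) => // n _ lt_van /=.
split; last first.
  by rewrite ltnS count_spaced // => j lt_j /lt_van; lia.
have -> : (2 * J m + 2 * count J (iota m.+1 n) = 2 * count J (iota m n.+1))%N.
  by rewrite /= mulnDr.
by rewrite count_spaced // => j lt_j /lt_van; lia.
Qed.

Lemma net_mu_gt0 (R : realDomainType) (p : {poly R}) (x : R) (J : pred nat) m :
    p^`(m) != 0 -> spaced J -> derivn_vanish p x J -> root p^`(m) x ->
  (0 < net_mu p x J m)%N.
Proof. by move=> pm0 spJ van rm; have [_] := count_net_mu pm0 spJ van rm; rewrite subn_gt0. Qed.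

Lemma net_mu_succ_root (R : realDomainType) (p : {poly R}) (x : R) (J : pred nat) m :
    p^`(m.+1) != 0 -> spaced J -> derivn_vanish p x J -> root p^`(m) x ->
  (net_mu p x J m + 2 * J m.+1 <= (net_mu p x J m.+1).+1)%N.
Proof.
move=> pm10 spJ van rm.
have pm0 : p^`(m) != 0 by apply: contraNneq pm10; rewrite derivnS => ->; rewrite deriv0.
have [_] := count_net_mu pm0 spJ van rm.
have muE : \mu_x p^`(m.+1) = (\mu_x p^`(m)).-1 by rewrite derivnS mu_deriv // subn1.
have cnt1 := count_net_mu pm10 spJ van.
have J1 : J m.+1 -> (0 < \mu_x p^`(m.+1))%N by move=> /van[r _]; rewrite mu_gt0.
rewrite /net_mu; move: cnt1 J1; rewrite -(mu_gt0 x pm10) muE.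
case: (\mu_x p^`(m)) => [|[|n]] //= cnt1 J1; first by case: (J m.+1) J1 => [/(_ isT)|].
by have [] := cnt1 isT; case: (J m.+1) => /=; lia.
Qed.

(** Pairs fill an even number of levels, so an odd multiplicity leaves one more level over. *)
Lemma odd_mu_le_net_mu (R : realDomainType) (p : {poly R}) (x : R) (J : pred nat) m :
    p^`(m) != 0 -> spaced J -> derivn_vanish p x J ->
  (odd (\mu_x p^`(m)) + 2 * J m <= net_mu p x J m)%N.
Proof.
move=> pm10 spJ van; have cnt1 := count_net_mu pm10 spJ van.
have J1 : J m -> (0 < \mu_x p^`(m))%N by move=> /van[r _]; rewrite mu_gt0.
rewrite /net_mu; move: cnt1 J1; rewrite -(mu_gt0 x pm10).
case: (\mu_x p^`(m)) => [|n] /= cnt1 J1; first by case: (J m) J1 => [/(_ isT)|].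
by have [] := cnt1 isT; case: (J m) => /=; lia.
Qed.

Lemma sum_net_mu_succ (R : rcfType) (p : {poly R}) (J : R -> pred nat)
    (Y : seq R) m : p^`(m.+1) != 0 -> (forall x, spaced (J x)) ->
    (forall x, derivn_vanish p x (J x)) -> uniq Y ->
    (forall x, root p^`(m.+1) x -> x \in Y) ->
  (\sum_(x <- Y) net_mu p x (J x) m + 2 * \sum_(x <- Y) J x m.+1
     <= (\sum_(x <- Y) net_mu p x (J x) m.+1).+1)%N.
Proof.
move=> pm10 spJ van uY sY.
have pm0 : p^`(m) != 0 by apply: contraNneq pm10; rewrite derivnS => ->; rewrite deriv0.
have leAC : (\sum_(x <- Y) root p^`(m) x <=
    (\sum_(x <- Y) (~~ root p^`(m) x && odd (\mu_x p^`(m.+1)))).+1)%N.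
  have := @count_roots_le_rolle R p^`(m) Y pm0 uY; rewrite -derivnS => /(_ sY).
  by rewrite -!sumn_count !sumnE !big_map.
suff : (\sum_(x <- Y) net_mu p x (J x) m + 2 * \sum_(x <- Y) J x m.+1
    + \sum_(x <- Y) (~~ root p^`(m) x && odd (\mu_x p^`(m.+1))) <=
   \sum_(x <- Y) net_mu p x (J x) m.+1 + \sum_(x <- Y) root p^`(m) x)%N by lia.
rewrite big_distrr /= -!big_split /=; apply: leq_sum => x _.
have [rx|nrx] /= := boolP (root p^`(m) x).
  by rewrite addn0 addn1 net_mu_succ_root.
have := odd_mu_le_net_mu pm10 (spJ x) (van x).
rewrite [net_mu p x (J x) m]/net_mu (muNroot nrx) /= sub0n add0n addn0.
by case: (odd _) => /=; lia.
Qed.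

(** * Covering by pairs, and interpolation *)

Definition level_spaced (A : eqType) (T : seq (A * nat)) :=
  forall x k, (x, k) \in T -> (x, k.+1) \notin T.

Lemma pair_cover (A : eqType) (K : seq (A * nat)) :
  exists T : seq (A * nat),
    [/\ uniq T, (size T <= size K)%N, level_spaced T,
        {in T, forall t, exists2 u, u \in K & (u.2 <= t.2)%N}
      & {in K, forall u, u \in T \/ exists2 k, u.2 = k.+1 & (u.1, k) \in T}].
Proof.
(* Greedily, by increasing level: an uncovered [(x, k)] starts a new pair. *)
pose r (u v : A * nat) := (v.2 <= u.2)%N.
have r_trans : transitive r by move=> u v w; rewrite /r => h /leq_trans; apply.
have r_total : total r by move=> u v; rewrite /r leq_total.
suff H s : sorted r s -> exists T : seq (A * nat),
    [/\ uniq T, (size T <= size s)%N, level_spaced T, {subset T <= s}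
      & {in s, forall u, u \in T \/ exists2 k, u.2 = k.+1 & (u.1, k) \in T}].
  have [T [uT sT dT TK KT]] := H _ (sort_sorted r_total K).
  exists T; split=> //; first by rewrite -(size_sort r K).
    by move=> t /TK; rewrite mem_sort; exists t.
  by move=> u uK; apply: KT; rewrite mem_sort.
(* Levels decrease along the list, so the tail, with the lower levels, is covered before the
   head. *)
elim: s => [|[x k] s IHs] /=; first by exists [::].
move=> pxs; have /(order_path_min r_trans)/allP xs := pxs.
have [T [uT sT dT Ts cov]] := IHs (path_sorted pxs).
have cov_cons (T' : seq (A * nat)) : {subset T <= T'} ->
    (x, k) \in T' \/ (exists2 j, k = j.+1 & (x, j) \in T') ->
    {in (x, k) :: s, forall u, u \in T' \/ exists2 j, u.2 = j.+1 & (u.1, j) \in T'}.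
  move=> TT' cov_x u; rewrite inE => /predU1P[->//|/cov[/TT'|[j -> /TT']]]; first by left.
  by right; exists j.
have [in_T|nin_T] := boolP ((x, k) \in T).
  exists T; split=> //; [exact: leqW | by move=> t /Ts; rewrite inE => ->; rewrite orbT|].
  by apply: cov_cons => //; left.
have [/andP[k0 in_T1]|nin_T1] := boolP ((0 < k)%N && ((x, k.-1) \in T)).
  exists T; split=> //; [exact: leqW | by move=> t /Ts; rewrite inE => ->; rewrite orbT|].
  by apply: cov_cons => //; right; exists k.-1; rewrite ?prednK.
exists ((x, k) :: T); split=> /=.
- by rewrite nin_T.
- by rewrite ltnS.
- move=> y j; rewrite !inE !xpair_eqE => /orP[/andP[/eqP-> /eqP->]|yj].
    rewrite eqxx (gtn_eqF (ltnSn k)) /=; apply/negP => /Ts/xs.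
    by rewrite /r /= ltnn.
  rewrite negb_or (dT _ _ yj) andbT; apply/negP => /andP[/eqP yx /eqP kj].
  by move: nin_T1; rewrite -kj -yx /= yj.
- by move=> t; rewrite !inE => /orP[->//|/Ts->]; rewrite orbT.
- by apply: cov_cons => [t|]; rewrite ?inE ?eqxx; [move=> -> ; rewrite orbT | left].
Qed.

(** The monomials ['X], ..., ['X^D] vanish at 0 and offer [D] coefficients, more than there are
    linear conditions. *)
Lemma exists_poly_derivn_roots (R : fieldType) (D : nat) (cs : seq (R * nat)) :
    (size cs < D)%N ->
  exists p : {poly R}, [/\ p != 0, (size p <= D.+1)%N, root p 0
    & {in cs, forall c, root p^`(c.2) c.1}].
Proof.
move=> lt_cs; pose c0 : R * nat := (0, 0%N).
pose c j := nth c0 cs j.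
pose M := \matrix_(i < D, j < size cs) (('X^(i.+1))^`((c j).2)).[(c j).1].
have : kermx M != 0.
  rewrite -mxrank_eq0 mxrank_ker subn_eq0 -ltnNge.
  exact: leq_ltn_trans (rank_leq_col M) lt_cs.
case/rowV0Pn => v /sub_kermxP vM v0; pose p := \sum_(i < D) v 0 i *: 'X^(i.+1).
have pE : p = \poly_(i < D) (if insub i is Some j then v 0 j else 0) * 'X.
  rewrite poly_def mulr_suml; apply: eq_bigr => i _.
  by rewrite valK -scalerAl -exprSr.
exists p; split.
- apply: contraNneq v0 => p0; apply/eqP/rowP => i; rewrite mxE.
  have := congr1 (fun q : {poly R} => q`_i.+1) p0.
  by rewrite pE coefMX coef_poly ltn_ord valK coef0.
- rewrite (leq_trans (size_sum _ _ _)) //; apply/bigmax_leqP => i _.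
  by rewrite (leq_trans (size_scale_leq _ _)) // size_polyXn ltnS.
- by rewrite pE rootM rootX eqxx orbT.
move=> u /(nthP c0)[j lt_j <-]; rewrite -/(c j).
have := congr1 (fun N : 'rV_(size cs) => N 0 (Ordinal lt_j)) vM.
rewrite !mxE /root => <-; apply/eqP.
rewrite /p linear_sum /= horner_sum; apply: eq_bigr => i _.
by rewrite derivnZ hornerZ !mxE.
Qed.

(** * Bounding the number of pairs by the degree *)

Lemma derivn_pair_count (R : rcfType) (p : {poly R}) (a b : R)
    (T : seq (R * nat)) :
    p != 0 -> a != b -> root p a -> root p b -> uniq T -> level_spaced T ->
    {in T, forall t, (0 < t.2)%N} ->
    {in T, forall t, root p^`(t.2) t.1 /\ root p^`(t.2.+1) t.1} ->
  (2 + 2 * count (fun t => t.2 <= (size p).-1) T <= (size p).-1)%N.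
Proof.
move=> p0 ab ra rb uT dT T0 vT.
pose J x : pred nat := fun k => (x, k) \in T.
have spJ x : spaced (J x) by move=> k; apply: dT.
have van x : derivn_vanish p x (J x) by move=> k /vT.
have pm0 m : (m < size p)%N -> p^`(m) != 0.
  by move=> lt_m; rewrite -size_poly_gt0 size_derivn subn_gt0.
(* One finite set holding the roots of all nonzero derivatives serves every level. *)
pose Y := undup (a :: b :: map fst T ++
   flatten [seq rootsR p^`(m) | m <- iota 0 (size p)]).
have uY : uniq Y by rewrite undup_uniq.
have aY : a \in Y by rewrite mem_undup mem_head.
have bY : b \in Y by rewrite mem_undup !inE eqxx orbT.
have TY t : t \in T -> t.1 \in Y.
  by move=> tT; rewrite mem_undup !inE mem_cat (map_f fst tT) ?orbT.
have rY m x : (m < size p)%N -> root p^`(m) x -> x \in Y.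
  move=> lt_m rx; rewrite mem_undup !inE mem_cat; apply/or4P/Or44.
  apply/flattenP; exists (rootsR p^`(m)); first by apply: map_f; rewrite mem_iota.
  by rewrite mem_rootsR ?pm0.
have TmY m : (count (fun t => t.2 == m) T <= \sum_(x <- Y) J x m)%N.
  have -> : (\sum_(x <- Y) J x m = count (fun x => J x m) Y)%N.
    by rewrite -sumn_count sumnE big_map.
  rewrite -!size_filter -(size_map fst); apply: uniq_leq_size.
    rewrite map_inj_in_uniq ?filter_uniq // => -[x i] [y j].
    by rewrite !mem_filter /= => /andP[/eqP-> _] /andP[/eqP-> _] ->.
  move=> x /mapP[[y j]]; rewrite !mem_filter /= => /andP[/eqP-> yT] ->.
  by rewrite (TY _ yT) andbT.
(* At level 0 the roots [a] and [b] give the 2, and no pair starts there. At level [deg p] the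
   derivative is a nonzero constant and the sum is 0. *)
have key m : (m < size p)%N ->
    (2 + 2 * count (fun t => t.2 <= m) T <= \sum_(x <- Y) net_mu p x (J x) m + m)%N.
  elim: m => [_|m IHm lt_m].
    have -> : count (fun t : R * nat => (t.2 <= 0)%N) T = 0%N.
      apply/eqP; rewrite -leqn0 leqNgt -has_count -all_predC; apply/allP => t /T0.
      by rewrite /= -ltnNge.
    rewrite muln0 !addn0 (big_rem a) //= (big_rem b) /=; last first.
      by rewrite mem_rem_uniq // inE bY eq_sym ab.
    have := @net_mu_gt0 R p a (J a) 0 p0 (spJ a) (van a) ra.
    have := @net_mu_gt0 R p b (J b) 0 p0 (spJ b) (van b) rb.
    lia.
  have step := sum_net_mu_succ (pm0 _ lt_m) spJ van uY (rY _ ^~ lt_m).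
  have -> : (count (fun t => t.2 <= m.+1) T =
      count (fun t => t.2 <= m) T + count (fun t => t.2 == m.+1) T)%N.
    rewrite -count_predUI [X in (_ + X)%N](_ : _ = 0%N) ?addn0.
      by apply: eq_count => t /=; rewrite leq_eqVlt ltnS orbC.
    apply/eqP; rewrite -leqn0 leqNgt -has_count; apply/hasP => -[t _ /=].
    by case/andP=> ? /eqP; lia.
  have arith (s s' t c j : nat) : (2 + 2 * t <= s + m -> c <= j ->
      s + 2 * j <= s'.+1 -> 2 + 2 * (t + c) <= s' + m.+1)%N by lia.
  exact: arith (IHm (ltnW lt_m)) (TmY m.+1) step.
have size0 : (0 < size p)%N by rewrite size_poly_gt0.
have := key (size p).-1; rewrite prednK // => /(_ (leqnn _)).
rewrite big1 // => x _.
have := pm0 (size p).-1; rewrite prednK // => /(_ (leqnn _)) pn0.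
have /size_poly1P[c c0 cE] : size p^`((size p).-1) == 1%N.
  by rewrite size_derivn; case: (size p) size0 => // n _; rewrite subSnn.
by rewrite /net_mu cE mu_polyC.
Qed.

(** * The apolar pairing *)

Lemma coef_XaddC_exp (R : comNzRingType) (a : R) (e i : nat) :
  (('X + a%:P) ^+ e)`_i = a ^+ (e - i) *+ 'C(e, i).
Proof.
have -> : ('X + a%:P) ^+ e = \poly_(j < e.+1) (a ^+ (e - j) *+ 'C(e, j)).
  rewrite addrC exprDn poly_def; apply: eq_bigr => j _.
  by rewrite -rmorphXn mul_polyC scalerMnl.
by rewrite coef_poly ltnS; case: leqP => // lt_ei; rewrite bin_small.
Qed.

(** Over the reals, [n!] times the classical pairing with weights [1 / 'C(n, i)], without its
    alternating signs. *)
Definition apolar (R : nzRingType) (n : nat) (p q : {poly R}) : R :=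
  \sum_(i < n.+1) p`_(n - i) * ((n - i)`! * i`!)%:R * q`_i.

Lemma apolar_XaddC_exp (R : realDomainType) (n e : nat) (p : {poly R}) (a : R) :
    (e <= n)%N -> (size p <= n.+1)%N ->
  apolar n p (('X + a%:P) ^+ e) = e`!%:R * p^`(n - e).[a].
Proof.
move=> le_en le_pn.
rewrite (@horner_coef_wide _ e.+1); last first.
  by rewrite size_derivn leq_subLR addnS subnK.
rewrite mulr_sumr (reindex_inj rev_ord_inj) /apolar /=.
rewrite (big_ord_widen n.+1 (fun i => e`!%:R * ((p^`(n - e))`_(e.+1 - i.+1) * a ^+ (e.+1 - i.+1)))) //.
rewrite [RHS]big_mkcond; apply: eq_bigr => i _; rewrite coef_XaddC_exp ltnS subSS.
have [le_ie|lt_ei] := leqP i e; last by rewrite bin_small // mulr0n mulr0.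
rewrite coef_derivn; have -> : (n - e + (e - i) = n - i)%N by lia.
rewrite -[_ ^+ _ *+ _]mulr_natr -[p`__ *+ _]mulr_natr.
(* The binomial coefficient and the derivative carry the same factorials, so the sums agree term by
   term. *)
have fE : ((n - i)`! * i`! * 'C(e, i) = e`! * (n - i) ^_ (n - e))%N.
  rewrite -(bin_fact le_ie) -(@ffact_fact (n - i) (n - e)); last lia.
  have -> : (n - i - (n - e) = e - i)%N by lia.
  by lia.
transitivity (p`_(n - i) * a ^+ (e - i) * ((n - i)`! * i`! * 'C(e, i))%:R).
  by rewrite mulrACA -natrM.
by rewrite fE natrM [in RHS]mulrAC mulrCA.
Qed.

(** * The lower bound on [l] *)

Theorem theorem15 (R : realType) (d l : nat)
    (beta y : 'I_l -> R) (e : 'I_l -> nat)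
    (he : forall i : 'I_l, (e i <= d)%N)
    (hH : H2 R d = \sum_(i < l) beta i *: ('X + (y i)%:P) ^+ e i) :
  (d%:R - 1) / 2%:R < l%:R :> R.
Proof.
(* Slightly stronger than the goal, which amounts to [d < 2 * l + 1]. *)
suff dl : (d < 2 * l)%N.
  rewrite ltr_pdivrMr ?ltr0n // ltrBlDr -natrM natr1 ltr_nat; lia.
rewrite ltnNge; apply/negP => le_ld.
pose K := [seq (y i, (d.+1 - e i)%N) | i : 'I_l].
have [T [uT sT dT TK KT]] := pair_cover K.
have sK : size K = l by rewrite size_map size_enum_ord.
have T0 : {in T, forall t, (0 < t.2)%N}.
  by move=> t /TK[u /mapP[i _ ->] /=]; have := he i; lia.
pose cnt D := count (fun t : R * nat => (t.2 <= D)%N) T.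
have cnt_le D : (cnt D <= l)%N by rewrite -sK (leq_trans (count_size _ _)).
have exD : exists D, (2 * cnt D < D)%N.
  by exists (2 * l).+1; have := cnt_le (2 * l).+1; lia.
case: (ex_minnP exD) => D cntD minD.
have leD : (D <= d.+1)%N.
  apply: leq_trans (minD (2 * l).+1 _) _; last lia.
  by have := cnt_le (2 * l).+1; lia.
pose TD := [seq t <- T | (t.2 <= D)%N].
have [|p [p0 le_pD rp0 van]] :=
  @exists_poly_derivn_roots R D (TD ++ [seq (t.1, t.2.+1) | t <- TD]).
  by rewrite size_cat size_map size_filter -/(cnt D); lia.
have vanT : {in T, forall t, root p^`(t.2) t.1 /\ root p^`(t.2.+1) t.1}.
  (* Pairs above level [D] come for free, since [p] has degree at most [D]. *)
  move=> t tT; have [le_tD|lt_Dt] := leqP t.2 D; last first.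
    have d0 k : (D < k)%N -> p^`(k) = 0.
      by move=> lt_Dk; apply/eqP; rewrite -derivn_poly0 (leq_trans le_pD).
    by rewrite !d0 ?root0 //; apply: ltnW.
  have tTD : t \in TD by rewrite mem_filter le_tD.
  split; first by apply: van; rewrite mem_cat tTD.
  apply: (van (t.1, t.2.+1)); rewrite mem_cat; apply/orP; right.
  by apply/mapP; exists t.
have rp1 : root p 1.
  have := congr1 (apolar d.+1 p) hH.
  have apolarB u v : apolar d.+1 p (u - v) = apolar d.+1 p u - apolar d.+1 p v.
    by rewrite /apolar -sumrB; apply: eq_bigr => i _; rewrite coefB mulrBr.
  have -> : H2 R d = ('X + 1%:P) ^+ d.+1 - ('X + 0%:P) ^+ d.+1 by rewrite addr0.
  rewrite apolarB !apolar_XaddC_exp ?(leq_trans le_pD) // subnn derivn0.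
  rewrite (rootP rp0) mulr0 subr0 => p1E.
  suff : (d.+1)`!%:R * p.[1] == 0.
    by rewrite mulf_eq0 pnatr_eq0 eqn0Ngt fact_gt0.
  rewrite p1E /apolar; apply/eqP.
  under eq_bigr do rewrite coef_sum mulr_sumr.
  rewrite exchange_big big1 //= => i _.
  transitivity (beta i * apolar d.+1 p (('X + (y i)%:P) ^+ e i)).
    by rewrite mulr_sumr; apply: eq_bigr => j _; rewrite coefZ mulrCA.
  have le_ei := he i.
  rewrite apolar_XaddC_exp ?(leq_trans le_pD) ?(leqW le_ei) //.
  (* Each condition is the lower or the upper member of a pair of [T]. *)
  have /KT[/vanT[/rootP->]|[k /= -> /vanT[_ /rootP ->]]] : (y i, (d.+1 - e i)%N) \in K.
  - by rewrite map_f ?mem_enum.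
  - by rewrite !mulr0.
  - by rewrite !mulr0.
have := derivn_pair_count p0 (oner_neq0 R) rp1 rp0 uT dT T0 vanT.
set n := (size p).-1 => le_n.
(* From [2 + 2 * cnt n <= n] it follows that [2 * cnt n.-1 < n.-1], at a level below the minimal
   [D]. *)
have lt_n : (n.-1 < D)%N by rewrite /n; lia.
have : (2 * cnt n.-1 < n.-1)%N -> False by move=> /minD; lia.
have : (cnt n.-1 <= cnt n)%N by apply: sub_count => t /=; lia.
by move: le_n; rewrite -/(cnt n); lia.
Qed.
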